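(* Let $W(x)=\sum_{n\ge3}d_{12\text{-}3}(n;y)x^n$, where $d_{12\text{-}3}(n;y)=\sum_{\pi\in\mathcal{D}_{12\text{-}3}(n)}y^{\mu(\pi)}$. Then, as formal power series in $x$, $$W(x)=x^3y\sum_{j\ge0}\frac{x^j\prod_{i=0}^j(1-ix+xy)}{(1-(j+1)x)\prod_{i=0}^j(1-ix)^2}.$$
   Context: Every permutation $\pi$ of $[n]=\{1,\dots,n\}$ is written in standard cycle form: each cycle is written starting with its smallest element, and the cycles are ordered from left to right by increasing first elements. The flattened form $\mathrm{flat}(\pi)$ is the word (in one-line notation) obtained by erasing the parentheses of the standard cycle form; e.g. $(135)(26)(478)$ has flattened form $13526478$. A derangement is a permutation with no fixed points; $\mathcal{D}(n)$ is the set of derangements of $[n]$, and $\mu(\pi)$ denotes the number of cycles of $\pi$. A word $w=w_1\cdots w_n$ of distinct integers contains the vincular pattern $12\text{-}3$ if there are indices $i$ and $k>i+1$ with $w_i<w_{i+1}<w_k$, and avoids it otherwise. $\mathcal{D}_{12\text{-}3}(n)$ is the set of $\pi\in\mathcal{D}(n)$ such that $\mathrm{flat}(\pi)$ avoids $12\text{-}3$. *)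

(* Defs.v *)
From HB Require Import structures.
From mathcomp Require Import all_boot all_order all_algebra all_fingroup.
(* Functional extensionality, and a choiceType structure on power series. *)
From mathcomp Require Import boolp.

Set Implicit Arguments.
Unset Strict Implicit.
Unset Printing Implicit Defensive.

Import GRing.Theory.

Local Open Scope ring_scope.

(** * Formal power series *)

Record fps (R : Type) := FPS { fps_coef : nat -> R }.

(* A wrapped type, so as not to meet pointwise structures on [nat -> R]. *)
HB.instance Definition _ (R : Type) := gen_eqMixin (fps R).
HB.instance Definition _ (R : Type) := gen_choiceMixin (fps R).

Lemma fpsP (R : Type) (a b : fps R) : fps_coef a =1 fps_coef b -> a = b.
Proof. by case: a b => [a] [b] /= /funext ->. Qed.

Definition fps_zero (R : comNzRingType) : fps R := FPS (fun=> 0).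
Definition fps_opp (R : comNzRingType) (a : fps R) : fps R :=
  FPS (fun n => - fps_coef a n).
Definition fps_add (R : comNzRingType) (a b : fps R) : fps R :=
  FPS (fun n => fps_coef a n + fps_coef b n).

Fact fps_addA (R : comNzRingType) : associative (@fps_add R).
Proof. by move=> a b c; apply: fpsP => n; apply: addrA. Qed.
Fact fps_addC (R : comNzRingType) : commutative (@fps_add R).
Proof. by move=> a b; apply: fpsP => n; apply: addrC. Qed.
Fact fps_add0 (R : comNzRingType) : left_id (@fps_zero R) (@fps_add R).
Proof. by move=> a; apply: fpsP => n; apply: add0r. Qed.
Fact fps_addN (R : comNzRingType) :
  left_inverse (@fps_zero R) (@fps_opp R) (@fps_add R).
Proof. by move=> a; apply: fpsP => n; apply: addNr. Qed.

HB.instance Definition _ (R : comNzRingType) := GRing.isZmodule.Build (fps R)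
  (@fps_addA R) (@fps_addC R) (@fps_add0 R) (@fps_addN R).

Definition fpsC (R : comNzRingType) (c : R) : fps R :=
  FPS (fun n => if n is 0%N then c else 0).
Definition fpsX (R : comNzRingType) : fps R := FPS (fun n => (n == 1%N)%:R).
Definition fps_mul (R : comNzRingType) (a b : fps R) : fps R :=
  FPS (fun n => \sum_(i < n.+1) fps_coef a i * fps_coef b (n - i)%N).

Definition fps_trunc (R : comNzRingType) (N : nat) (a : fps R) : {poly R} :=
  \poly_(i < N) fps_coef a i.

Lemma fps_coef_mul (R : comNzRingType) (N : nat) (a b : fps R) (n : nat) :
  (n < N)%N -> fps_coef (fps_mul a b) n = (fps_trunc N a * fps_trunc N b)`_n.
Proof.
move=> ltnN; rewrite coefM /=; apply: eq_bigr => i _.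
rewrite !coef_poly (leq_trans (ltn_ord i)) //.
by rewrite (leq_ltn_trans (leq_subr _ _)).
Qed.

Fact fps_mulA (R : comNzRingType) : associative (@fps_mul R).
Proof.
move=> a b c; apply: fpsP => n.
transitivity ((fps_trunc n.+1 a * fps_trunc n.+1 b * fps_trunc n.+1 c)`_n).
  rewrite -mulrA coefM [LHS]/=; apply: eq_bigr => i _.
  rewrite coef_poly ltn_ord; congr (_ * _); apply: fps_coef_mul.
  by rewrite ltnS leq_subr.
rewrite coefM [RHS]/=; apply: eq_bigr => i _.
rewrite (coef_poly _ _ (n - i)) ltnS leq_subr; congr (_ * _).
exact/esym/fps_coef_mul.
Qed.

Fact fps_mulC (R : comNzRingType) : commutative (@fps_mul R).
Proof.
move=> a b; apply: fpsP => n.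
by rewrite !(@fps_coef_mul R n.+1) // mulrC.
Qed.

Fact fps_mul1 (R : comNzRingType) : left_id (fpsC (1 : R)) (@fps_mul R).
Proof.
move=> a; apply: fpsP => n /=.
rewrite big_ord_recl mul1r subn0 big1 ?addr0 // => i _.
by rewrite mul0r.
Qed.

Fact fps_mulDl (R : comNzRingType) :
  left_distributive (@fps_mul R) (@fps_add R).
Proof.
move=> a b c; apply: fpsP => n /=; rewrite -big_split.
by apply: eq_bigr => i _; rewrite mulrDl.
Qed.

Fact fps_oner_neq0 (R : comNzRingType) : fpsC (1 : R) != 0.
Proof.
apply/eqP => /(congr1 (fun a => fps_coef a 0)) /= /eqP.
by rewrite oner_eq0.
Qed.

HB.instance Definition _ (R : comNzRingType) :=
  GRing.Zmodule_isComNzRing.Build (fps R)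
    (@fps_mulA R) (@fps_mulC R) (@fps_mul1 R) (@fps_mulDl R)
    (@fps_oner_neq0 R).

(* The first [n] coefficients of the inverse of [a], from a * b = 1. *)
Fixpoint fps_inv_seq (R : comUnitRingType) (a : fps R) (n : nat) : seq R :=
  if n is m.+1 then
    let s := fps_inv_seq a m in
    rcons s ((fps_coef a 0)^-1 *
             ((m == 0%N)%:R - \sum_(i < m) s`_i * fps_coef a (m - i)%N))
  else [::].

Definition fps_unit (R : comUnitRingType) : {pred fps R} :=
  fun a => fps_coef a 0 \is a GRing.unit.

(* As for every unitRingType, the inverse of a nonunit is itself. *)
Definition fps_inv (R : comUnitRingType) (a : fps R) : fps R :=
  if a \in @fps_unit R then FPS (fun n => (fps_inv_seq a n.+1)`_n) else a.

Lemma size_fps_inv_seq (R : comUnitRingType) (a : fps R) (n : nat) :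
  size (fps_inv_seq a n) = n.
Proof. by elim: n => //= n IHn; rewrite size_rcons IHn. Qed.

Lemma nth_fps_inv_seq (R : comUnitRingType) (a : fps R) (n i : nat) :
  (i < n)%N -> (fps_inv_seq a n)`_i = (fps_inv_seq a i.+1)`_i.
Proof.
elim: n => // n IHn; rewrite ltnS leq_eqVlt => /predU1P[-> //| lt_in].
by rewrite [in LHS]/= nth_rcons size_fps_inv_seq lt_in IHn.
Qed.

Fact fps_mulVx (R : comUnitRingType) :
  {in @fps_unit R, left_inverse 1 (@fps_inv R) *%R}.
Proof.
move=> a Ua; rewrite /fps_inv Ua; apply: fpsP => n.
rewrite [LHS]/= big_ord_recr subnn.
set b := fps_inv_seq a; have -> : (b n.+1)`_n = (fps_coef a 0)^-1 *
    ((n == 0%N)%:R - \sum_(i < n) (b n)`_i * fps_coef a (n - i)%N).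
  by rewrite /b /= nth_rcons size_fps_inv_seq ltnn eqxx.
rewrite mulrAC mulVr // mul1r.
under eq_bigr => i _ do rewrite -(nth_fps_inv_seq a (ltn_ord i)).
by rewrite [LHS]addrC /= subrK; case: n.
Qed.

Fact fps_unitPl (R : comUnitRingType) (a b : fps R) :
  b * a = 1 -> fps_unit a.
Proof.
move=> /(congr1 (fun c => fps_coef c 0)) /=.
rewrite big_ord1 subnn => ba1; apply/unitrPr; exists (fps_coef b 0).
by rewrite mulrC.
Qed.

Fact fps_inv_out (R : comUnitRingType) :
  {in [predC @fps_unit R], @fps_inv R =1 id}.
Proof. by move=> a /negbTE Ua; rewrite /fps_inv Ua. Qed.

HB.instance Definition _ (R : comUnitRingType) :=
  GRing.ComNzRing_hasMulInverse.Build (fps R)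
    (@fps_mulVx R) (@fps_unitPl R) (@fps_inv_out R).

(* Convergence of the partial sums to [S] in the X-adic topology. *)
Definition fps_has_sum (R : comNzRingType) (F : nat -> fps R) (S : fps R) :=
  forall n : nat, exists N : nat, forall m : nat, (N <= m)%N ->
    fps_coef (\sum_(j < m) F j) n = fps_coef S n.

(** * Permutations in flattened form

   [i : 'I_n] stands for the element [i.+1] of {1, ..., n}. *)

(* [fingraph.orbit s i] is the sequence i, s i, s (s i), ..., and [enum] lists
   'I_n in increasing order. *)
Definition standard_cycle_form (n : nat) (s : 'S_n) : seq (seq 'I_n) :=
  [seq fingraph.orbit s i |
     i <- enum 'I_n & [forall j in porbit s i, i <= j]%N].

Definition flat (n : nat) (s : 'S_n) : seq nat :=
  [seq (val i).+1 | i <- flatten (standard_cycle_form s)].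

Definition derangement (n : nat) (s : 'S_n) : bool := [forall i, s i != i].

Definition contains_12_3 (w : seq nat) : bool :=
  [exists i : 'I_(size w), exists k : 'I_(size w),
    (i.+1 < k)%N && (nth 0%N w i < nth 0%N w i.+1 < nth 0%N w k)%N].

Definition D_12_3 (n : nat) : {set 'S_n} :=
  [set s : 'S_n | derangement s && ~~ contains_12_3 (flat s)].

Definition d_12_3 (n : nat) : {poly int} :=
  \sum_(s in D_12_3 n) 'X ^+ #|porbits s|.

Definition W : fps {poly int} :=
  FPS (fun n => if (3 <= n)%N then d_12_3 n else 0).

(* Main.v *)
Require Import Defs.
From HB Require Import structures.
From mathcomp Require Import all_boot all_order all_algebra all_fingroup.
From mathcomp Require Import ring zify.

Set Implicit Arguments.
Unset Strict Implicit.
Unset Printing Implicit Defensive.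

Import GRing.Theory.

Local Open Scope ring_scope.

(** The flattened form of a permutation starts with 1, so if it avoids 12-3 its
second letter is n. More generally, if a word avoids 12-3 and M is its largest
letter, then the letters before M decrease and the word after M is an arbitrary
avoiding word. A cycle starts at a letter smaller than everything after it; in
the decreasing part this is possible only for the last letter, when it is the
minimum of the whole word. Hence, if f(m) counts by new cycles the ways to
continue an open cycle with m further letters, d(n) = y f(n - 2) and
  f(m + 2) = sum_j C(m, j) ((1 + y) f(j) + f(j + 1)).
For the series g of the f(m + 1) this says
  g(x) = (1 + xy) / (1 - x) + x (1 + xy) / (1 - x)^2 g(x / (1 - x)),
and iterating this equation produces the summands of the theorem one by one. *)

(** * The functional equation of the series *)

Section FormalPowerSeries.

Variable R : comUnitRingType.
Implicit Types (a b c : fps R) (n m k : nat).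

Local Notation x := (fpsX R).

Lemma coef_fpsD a b n : fps_coef (a + b) n = fps_coef a n + fps_coef b n.
Proof. by []. Qed.

Lemma coef_fpsB a b n : fps_coef (a - b) n = fps_coef a n - fps_coef b n.
Proof. by []. Qed.

Lemma coef_fps1 n : fps_coef (1 : fps R) n = (n == 0%N)%:R.
Proof. by case: n. Qed.

Lemma coef_fpsXM a n :
  fps_coef (x * a) n = if n is k.+1 then fps_coef a k else 0.
Proof.
case: n => [|n]; first by rewrite /= big_ord1 mul0r.
rewrite /= 2!big_ord_recl /= mul0r add0r mul1r subSS subn0 big1 ?addr0 //.
by move=> i _; rewrite mul0r.
Qed.

Lemma coef_fpsXnM a k n :
  fps_coef (x ^+ k * a) n = if (n < k)%N then 0 else fps_coef a (n - k).
Proof.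
elim: k n => [|k IHk] n; first by rewrite mul1r subn0.
by rewrite exprS -mulrA coef_fpsXM; case: n => // n; rewrite IHk.
Qed.

Lemma coef_fpsCM (u : R) a n : fps_coef (fpsC u * a) n = u * fps_coef a n.
Proof.
rewrite /= big_ord_recl subn0 big1 ?addr0 // => i _.
by rewrite mul0r.
Qed.

Lemma unit_fpsBXM a : 1 - a * x \is a GRing.unit.
Proof.
rewrite mulrC; suff : fps_coef (1 - x * a) 0 \is a GRing.unit by [].
by rewrite coef_fpsD /= big_ord1 mul0r oppr0 addr0 unitr1.
Qed.

Lemma unit_fpsBX : 1 - x \is a GRing.unit.
Proof. by rewrite -[x]mul1r unit_fpsBXM. Qed.

(** * The binomial transform and the substitution of x / (1 - x) *)

Definition binomial_transform a : fps R :=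
  FPS (fun n => \sum_(i < n.+1) fps_coef a i *+ 'C(n, i)).

Local Notation T := binomial_transform.

Lemma coef_binomial_transform a n :
  fps_coef (T a) n = \sum_(i < n.+1) fps_coef a i *+ 'C(n, i).
Proof. by []. Qed.

Fact binomial_transform_is_zmod_morphism : zmod_morphism T.
Proof.
move=> a b; apply: fpsP => n /=; rewrite -sumrB.
by apply: eq_bigr => i _; rewrite mulrnBl.
Qed.

HB.instance Definition _ := GRing.isZmodMorphism.Build (fps R) (fps R) T
  binomial_transform_is_zmod_morphism.

Lemma binomial_transformCM (u : R) a : T (fpsC u * a) = fpsC u * T a.
Proof.
apply: fpsP => n; rewrite coef_fpsCM [RHS]mulr_sumr; apply: eq_bigr => i _.
by rewrite coef_fpsCM mulrnAr.
Qed.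

(** Coefficientwise this is Pascal's rule: C(n + 1, i + 1) - C(n, i + 1) = C(n, i). *)
Lemma binomial_transformXM a : (1 - x) * T (x * a) = x * T a.
Proof.
apply: fpsP => n; rewrite mulrBl mul1r coef_fpsB !coef_fpsXM.
have TXM k :
    fps_coef (T (x * a)) k = \sum_(i < k) fps_coef a i *+ 'C(k, i.+1).
  rewrite coef_binomial_transform big_ord_recl coef_fpsXM mul0rn add0r.
  by apply: eq_bigr => i _; rewrite coef_fpsXM.
case: n => [|n]; first by rewrite TXM big_ord0 subr0.
rewrite !TXM coef_binomial_transform big_ord_recr [in RHS]big_ord_recr !binn.
under eq_bigr => i _ do rewrite binS mulrnDr.
by rewrite big_split [LHS]addrAC [X in X - _]addrC addrK.
Qed.

Lemma binomial_transform1 : (1 - x) * T 1 = 1.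
Proof.
have T1 n : fps_coef (T 1) n = 1.
  rewrite /= big_ord_recl bin0 big1 ?addr0 // => i _.
  by rewrite mul0rn.
apply: fpsP => n; rewrite mulrBl mul1r coef_fpsB coef_fpsXM coef_fps1 T1.
by case: n => [|n]; rewrite ?T1 ?subr0 ?subrr.
Qed.

(* [T] is, up to the factor [1 / (1 - x)], the substitution of [x / (1 - x)]
   for [x]: if [b] is [a(x / (1 - x))] with its denominator [(1 - x) ^+ k]
   cleared, then multiplication by [a] becomes multiplication by [b]. *)
Definition transforms_to k a b := forall c, (1 - x) ^+ k * T (a * c) = b * T c.

Lemma transforms_to1 : transforms_to 0 1 1.
Proof. by move=> c; rewrite !mul1r. Qed.

Lemma transforms_toM k l a b a' b' : transforms_to k a b ->
  transforms_to l a' b' -> transforms_to (k + l) (a * a') (b * b').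
Proof.
move=> ab a'b' c; rewrite exprD mulrAC -!mulrA (mulrC (T _)) mulrCA ab.
by rewrite mulrCA a'b'.
Qed.

Lemma transforms_to_prod k m (A B : nat -> fps R) :
  (forall i, transforms_to k (A i) (B i)) ->
  transforms_to (k * m) (\prod_(0 <= i < m) A i) (\prod_(0 <= i < m) B i).
Proof.
move=> AB; elim: m => [|m IHm].
  by rewrite !big_nil muln0; apply: transforms_to1.
by rewrite !big_nat_recr //= mulnS addnC; apply: transforms_toM.
Qed.

Lemma transforms_toX k : transforms_to k (x ^+ k) (x ^+ k).
Proof.
elim: k => [|k IHk]; first exact: transforms_to1.
rewrite !exprS -add1n; apply: transforms_toM => // c.
exact: binomial_transformXM.
Qed.

(** Putting x / (1 - x) for x and clearing the denominator turns the leading 1 into 1 - x, which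
    raises i by one. This shift makes the products of the theorem grow by one factor at each
    iteration. *)
Lemma transforms_to_affine (u : R) i :
  transforms_to 1 (1 - i%:R * x + x * fpsC u) (1 - i.+1%:R * x + x * fpsC u).
Proof.
move=> c; have -> : (1 - i%:R * x + x * fpsC u) * c =
    c - (x * c) *+ i + fpsC u * (x * c) by rewrite -mulr_natl; ring.
rewrite raddfD raddfB raddfMn /= binomial_transformCM expr1.
move: (T c) (T (x * c)) (binomial_transformXM c) => a b TXM.
rewrite -mulr_natl (_ : _ * _ = (1 - x) * a - i%:R * ((1 - x) * b) +
  fpsC u * ((1 - x) * b)); last by ring.
by rewrite TXM mulrS; ring.
Qed.

Lemma transforms_to_linear i : transforms_to 1 (1 - i%:R * x) (1 - i.+1%:R * x).
Proof.
have := transforms_to_affine 0 i.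
have -> : fpsC (0 : R) = 0 by apply: fpsP; case.
by rewrite mulr0 !addr0.
Qed.

(** * The summands as iterates of the linear part of the functional equation *)

Variable u : R.
Local Notation y := (fpsC u).

Definition summand (j : nat) : fps R :=
  x ^+ j * \prod_(0 <= i < j.+1) (1 - i%:R * x + x * y)
  / ((1 - j.+1%:R * x) * \prod_(0 <= i < j.+1) (1 - i%:R * x) ^+ 2).

(** The linear part of the equation for g in the header; only one 1 / (1 - x) is written because [T]
    already carries the other. *)
Definition next_summand a : fps R := x * ((1 + x * y) / (1 - x) * T a).

Lemma unit_summand_denominator j k : (1 - k%:R * x) *
  \prod_(0 <= i < j) (1 - i%:R * x) ^+ 2 \is a GRing.unit.
Proof.
rewrite unitrM unit_fpsBXM /=; elim: j => [|j IHj].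
  by rewrite big_nil unitr1.
by rewrite big_nat_recr //= unitrM IHj unitrX ?unit_fpsBXM.
Qed.

(** The substitution shifts every factor from i to i + 1. The missing factor i = 0 is 1 + xy in the
    numerator, supplied by [next_summand], and 1 in the denominator. *)
Lemma summandS j : summand j.+1 = next_summand (summand j).
Proof.
set num := x ^+ j * \prod_(0 <= i < j.+1) (1 - i.+1%:R * x + x * y).
set den := (1 - j.+2%:R * x) * \prod_(0 <= i < j.+1) (1 - i.+1%:R * x) ^+ 2.
have denE : (1 - j.+2%:R * x) * \prod_(0 <= i < j.+2) (1 - i%:R * x) ^+ 2 = den.
  by rewrite big_nat_recl //= mul0r subr0 expr1n mul1r.
have numE : x ^+ j.+1 * \prod_(0 <= i < j.+2) (1 - i%:R * x + x * y) =
    x * (1 + x * y) * num.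
  by rewrite big_nat_recl //= mul0r subr0 exprS /num; ring.
have Uden : den \is a GRing.unit by rewrite -denE unit_summand_denominator.
suff Tj : den * T (summand j) = (1 - x) * num.
  rewrite /summand denE numE /next_summand -[T _](mulKr Uden) Tj.
  clearbody num den; rewrite -!mulrA; congr (_ * (_ * _)).
  by rewrite [_ * (_ * num)]mulrCA mulKr ?unit_fpsBX // mulrC.
have Hnum : transforms_to (j + 1 * j.+1) (x ^+ j *
    \prod_(0 <= i < j.+1) (1 - i%:R * x + x * y)) num.
  apply: transforms_toM; first exact: transforms_toX.
  by apply: transforms_to_prod => i; apply: transforms_to_affine.
have Hden : transforms_to (1 + 2 * j.+1) ((1 - j.+1%:R * x) *
    \prod_(0 <= i < j.+1) (1 - i%:R * x) ^+ 2) den.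
  apply: transforms_toM; first exact: transforms_to_linear.
  apply: transforms_to_prod => i; rewrite -[2%N]/(1 + 1)%N !expr2.
  by apply: transforms_toM; apply: transforms_to_linear.
apply: (mulrI (unitrX (j + 1 * j.+1) unit_fpsBX)).
have := Hden (summand j).
rewrite [X in T X]mulrC divrK ?unit_summand_denominator // => <-.
rewrite mulrCA -[X in T X]mulr1 Hnum; clearbody num den.
(* The denominator absorbs 2j + 3 factors 1 - x and the numerator 2j + 1. Of the two left over, one
   cancels against [T 1], which is 1 / (1 - x). *)
rewrite (_ : 1 + _ = (j + 1 * j.+1) + 2)%N; last by rewrite mul1n mul2n; lia.
rewrite exprD -mulrA; congr (_ * _); rewrite expr2 -mulrA; congr (_ * _).
by rewrite mulrCA binomial_transform1 mulr1.
Qed.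

Definition eq_upto n a b := forall i, (i < n)%N -> fps_coef a i = fps_coef b i.

Lemma eq_uptoM n c a b : eq_upto n a b -> eq_upto n (c * a) (c * b).
Proof.
move=> ab i lt_in; apply: eq_bigr => k _; rewrite ab //.
exact: leq_ltn_trans (leq_subr _ _) lt_in.
Qed.

(** [T] and products look only at coefficients of index at most i, and the factor x gains one more:
    the operator is contracting for the x-adic topology. *)
Lemma eq_upto_next_summand n a b :
  eq_upto n a b -> eq_upto n.+1 (next_summand a) (next_summand b).
Proof.
move=> ab [|i] lt_in; rewrite !coef_fpsXM //.
apply: (@eq_uptoM n) => // k lt_kn; apply: eq_bigr => l _; rewrite ab //.
by rewrite (leq_trans (ltn_ord l)).
Qed.

Lemma next_summand_sum m (F : nat -> fps R) :
  next_summand (\sum_(j < m) F j) = \sum_(j < m) next_summand (F j).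
Proof. by rewrite /next_summand raddf_sum !mulr_sumr. Qed.

(** Summand j is divisible by x ^ j, so coefficient n of the partial sums no longer changes after n
    + 1 summands. *)
Definition summand_series : fps R :=
  FPS (fun n => fps_coef (\sum_(j < n.+1) summand j) n).

Lemma coef_summand_series n m : (n < m)%N ->
  fps_coef (\sum_(j < m) summand j) n = fps_coef summand_series n.
Proof.
elim: m => // m IHm; rewrite ltnS leq_eqVlt => /predU1P[-> //|lt_nm].
rewrite big_ord_recr coef_fpsD IHm // /summand -mulrA coef_fpsXnM lt_nm.
exact: addr0.
Qed.

Lemma summand_has_sum : fps_has_sum summand summand_series.
Proof. by move=> n; exists n.+1 => m; apply: coef_summand_series. Qed.

Lemma summand_seriesE :
  summand_series = summand 0 + next_summand summand_series.
Proof.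
apply: fpsP => n; rewrite -(@coef_summand_series n n.+1) // big_ord_recl.
rewrite !coef_fpsD; congr (_ + _).
under eq_bigr => j _ do rewrite summandS.
(* By contraction, coefficient n of the image depends only on coefficients below n, where the
   partial sum already agrees with its limit. *)
rewrite -next_summand_sum; apply: (@eq_upto_next_summand n) => // i lt_in.
exact: coef_summand_series.
Qed.

(* The polynomial f(m) of the header, at y = u. *)
Definition tail_poly (m : nat) : R :=
  if m is k.+1 then fps_coef summand_series k else 1.

(** Since 1 + xg is the series of all the f(j), this is the recurrence of the header in terms of
    series. Multiplied by 1 - x, it becomes the functional equation. *)
Lemma summand_series_eq1 : summand_series =
  1 + x * (fpsC (1 + u) * T (1 + x * summand_series) + T summand_series).
Proof.
have CD : fpsC (1 + u) = 1 + y.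
  by apply: fpsP => -[|n] //; rewrite coef_fpsD addr0.
apply: (mulrI unit_fpsBX); rewrite {1}summand_seriesE raddfD /=.
have -> : (1 - x) * (summand 0 + next_summand summand_series) =
    (1 + x * y) + x * ((1 + x * y) * T summand_series).
  rewrite /next_summand /summand !big_nat1 mul0r subr0 expr1n mulr1 !mul1r.
  rewrite mulrDr mulrCA divrr ?unit_fpsBX // mulr1; congr (_ + _).
  rewrite [LHS]mulrCA; congr (_ * _); rewrite mulrA [in LHS]mulrCA divrr.
    by rewrite mulr1.
  exact: unit_fpsBX.
move: (T summand_series) (T 1) (T (x * _)) binomial_transform1
  (binomial_transformXM summand_series) => TS T1 TXS T1E TXSE.
rewrite [RHS](_ : _ = 1 - x + x * (fpsC (1 + u) * ((1 - x) * T1 + (1 - x) * TXS)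
  + (1 - x) * TS)); last by ring.
by rewrite TXSE T1E CD; ring.
Qed.

Lemma tail_polySS m : tail_poly m.+2 =
  \sum_(j < m.+1) ((1 + u) * tail_poly j + tail_poly j.+1) *+ 'C(m, j).
Proof.
rewrite -[LHS]/(fps_coef summand_series m.+1) summand_series_eq1.
rewrite coef_fpsD coef_fpsXM add0r coef_fpsD.
rewrite coef_fpsCM !coef_binomial_transform.
under [RHS]eq_bigr => j _ do rewrite mulrnDl -mulrnAr.
rewrite big_split mulr_sumr; congr (_ + _); apply: eq_bigr => j _.
rewrite coef_fpsD coef_fpsXM coef_fps1.
by case: (val j) => [|k]; rewrite ?addr0 ?add0r.
Qed.

Lemma tail_poly1 : tail_poly 1 = 1.
Proof. by rewrite /tail_poly summand_series_eq1 coef_fpsD coef_fpsXM addr0. Qed.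

End FormalPowerSeries.

(** * Avoiding words cut at their maximum *)

Section Subsets.

Variables (T : finType) (V : nmodType).
Implicit Types A B : {set T}.

(** Serves to put the two cases of the enumeration over the same index set, by splitting on whether
    the minimum m comes after the maximum. *)
Lemma sum_powersetU1 (F : {set T} -> V) A m : m \notin A ->
  \sum_(B in powerset (m |: A)) F B =
  \sum_(B in powerset A) (F B + F (m |: B)).
Proof.
move=> mA; rewrite (bigID (fun B => m \in B)) big_split /= addrC; congr (_ + _).
  apply: eq_bigl => B; rewrite !powersetE; apply/andP/idP => [[BmA mB]|BA].
    apply/subsetP => z zB; have := subsetP BmA z zB.
    by rewrite !inE => /predU1P[zm|//]; rewrite -zm zB in mB.
  split; first exact: subset_trans BA (subsetUr _ _).
  by apply: contra mA => /(subsetP BA).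
rewrite (reindex_onto (fun B => m |: B) (fun B => B :\ m)) /=; last first.
  by move=> B /andP[_ mB]; rewrite setD1K.
apply: eq_bigl => B; rewrite !powersetE setU11 andbT.
apply/andP/idP => [[BmA /eqP eqB]|BA].
  apply/subsetP => z zB; have := subsetP BmA z; rewrite !inE zB orbT.
  by move=> /(_ isT)/predU1P[zm|//]; move: zB; rewrite -eqB zm !inE eqxx.
split; first exact: setUS.
by rewrite setU1K //; apply: contra mA => /(subsetP BA).
Qed.

Lemma sum_powerset_card (F : nat -> V) A :
  \sum_(B in powerset A) F #|B| = \sum_(j < #|A|.+1) F j *+ 'C(#|A|, j).
Proof.
rewrite (partition_big (fun B => inord #|B| : 'I_#|A|.+1) xpredT) //=.
apply: eq_bigr => j _; rewrite -cards_draws -sumr_const.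
apply: eq_big => [B|B]; rewrite !inE.
  case: (boolP (B \subset A)) => //= BA.
  by rewrite -val_eqE /= inordK // ltnS subset_leq_card.
by case/andP=> BA /eqP <-; rewrite inordK // ltnS subset_leq_card.
Qed.

End Subsets.

Section Tails.

Variable n : nat.
Implicit Types (w r a b : seq 'I_n) (css : seq (seq 'I_n)) (A B C : {set 'I_n}).
Implicit Types (p : seq 'I_n * seq (seq 'I_n)) (M m : 'I_n).

Local Notation ge_ord := (fun i j : 'I_n => (j <= i)%N).

(** A structural recursion, convenient for cutting words; [contains_12_3_flat] links it to the
    index-based pattern. *)
Fixpoint avoids_12_3 w : bool :=
  if w is c :: w' then
    (if w' is d :: v then (c < d)%N ==> all (fun e : 'I_n => (e <= d)%N) v
     else true)
    && avoids_12_3 w'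
  else true.

Lemma avoids_12_3_catr a b : avoids_12_3 (a ++ b) -> avoids_12_3 b.
Proof. by elim: a => //= c a IHa /andP[_]. Qed.

(** An ascent inside a would be completed to 12-3 by M. The ascent into M is harmless, as nothing
    later exceeds M, and M itself is followed by a descent. *)
Lemma avoids_12_3_max a M b :
  all (fun z : 'I_n => (z < M)%N) a -> all (fun z : 'I_n => (z < M)%N) b ->
  avoids_12_3 (a ++ M :: b) = sorted ge_ord a && avoids_12_3 b.
Proof.
move=> + ltbM; elim: a => [_|c a IHa] /=.
  case: b ltbM => //= d b /andP[ltdM _].
  by rewrite (ltnNge M) (ltnW ltdM).
case/andP=> ltcM ltaM; rewrite {}IHa //; case: a ltaM => [_|d a] /=.
  rewrite ltcM (_ : all _ b) //.
  by apply: sub_all ltbM => z /ltnW.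
case/andP=> ltdM _; rewrite all_cat /= [(M <= d)%N]leqNgt ltdM andbF implybF.
by rewrite -leqNgt andbA.
Qed.

(** A single condition covers both requirements of standard form: a head below every later letter of
    the word is the minimum of its cycle and lies below all later heads. *)
Fixpoint standard css : bool :=
  if css is c :: css' then
    (if c is h :: t then all (fun e : 'I_n => (h < e)%N) (t ++ flatten css')
     else false)
    && standard css'
  else true.

Definition arranges A w : bool := uniq w && ([set z in w] == A).

Lemma arrangesP A w : reflect (uniq w /\ w =i A) (arranges A w).
Proof.
apply: (iffP andP) => -[Uw wA]; split=> //.
  by move=> z; rewrite -(eqP wA) inE.
by apply/eqP/setP => z; rewrite inE wA.
Qed.

Lemma arranges_id w : uniq w -> arranges [set z in w] w.
Proof. by rewrite /arranges eqxx andbT. Qed.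

Definition decreasing A : seq 'I_n := rev (enum A).

Lemma decreasing_sorted A : sorted ge_ord (decreasing A).
Proof.
rewrite rev_sorted (_ : enum A = [seq i <- enum 'I_n | i \in A]); last first.
  by rewrite enumT.
apply: sorted_filter; first by move=> j i k; apply: leq_trans.
by have := iota_sorted 0 n; rewrite -val_enum_ord sorted_map.
Qed.

Lemma sorted_rcons_ge w m : sorted ge_ord (rcons w m) =
  all (fun z : 'I_n => (m <= z)%N) w && sorted ge_ord w.
Proof.
have tr : transitive ge_ord by move=> j i k /= ji kj; apply: leq_trans kj ji.
by rewrite !(sorted_pairwise tr) pairwise_rcons.
Qed.

Lemma arranges_decreasing A : arranges A (decreasing A).
Proof.
apply/arrangesP; rewrite rev_uniq enum_uniq; split=> // z.
by rewrite mem_rev mem_enum.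
Qed.

Lemma sorted_arranges A w :
  arranges A w -> sorted ge_ord w -> w = decreasing A.
Proof.
move=> /arrangesP[Uw wA] sw; apply: (sorted_eq (leT := ge_ord)) => //.
- by move=> j i k /= ji kj; apply: leq_trans kj ji.
- by move=> i j; rewrite andbC -eqn_leq => /eqP/val_inj.
- exact: decreasing_sorted.
have /arrangesP[Ud dA] := arranges_decreasing A.
by apply: uniq_perm => // z; rewrite wA dA.
Qed.

(* What is left of a standard cycle form after some prefix of its word: the
   rest [p.1] of a cycle already opened, followed by the cycles [p.2]. *)
Definition tail A p : bool :=
  [&& arranges A (p.1 ++ flatten p.2), avoids_12_3 (p.1 ++ flatten p.2),
      standard p.2 & all (fun c => 1 < size c)%N p.2].

Lemma tail_set0 p : tail set0 p = (p == ([::], [::])).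
Proof.
apply/idP/eqP => [|->]; last first.
  by rewrite /tail /= !andbT; apply/arrangesP; split=> // z; rewrite !inE.
case/and4P=> /arrangesP[_ w0] _ std _; case: p w0 std => [[|z r] css] /=.
  by case: css => [//|[//|z c] css] /(_ z); rewrite !inE eqxx.
by move=> /(_ z); rewrite !inE eqxx.
Qed.

(** * Decomposition of a tail at its largest letter *)

Section SplitAtMax.

Variables (A : {set 'I_n}) (M : 'I_n).
Hypotheses (MA : M \in A) (maxM : forall z, z \in A -> (z <= M)%N).

Lemma lt_max z : z \in A :\ M -> (z < M)%N.
Proof.
by rewrite !inE => /andP[zM /maxM]; rewrite leq_eqVlt val_eqE (negPf zM).
Qed.

Lemma arranges_split a b : arranges A (a ++ M :: b) ->
  let B := [set z in b] in
  [/\ arranges (A :\ M :\: B) a, arranges B b & B \subset A :\ M].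
Proof.
case/arrangesP; rewrite cat_uniq cons_uniq => /and3P[Ua + /andP[Mb Ub]] wA B.
rewrite /= negb_or => /andP[Ma /hasPn ab]; split; last first.
- apply/subsetP => z; rewrite !inE -wA mem_cat inE => zb.
  by rewrite zb !orbT andbT; apply: contraNneq Mb => <-.
- exact: arranges_id.
apply/arrangesP; split=> // z; rewrite !inE -wA mem_cat inE.
case: (boolP (z \in a)) => za /=; last by case: eqP => //=; case: (z \in b).
rewrite andbT; apply/esym/andP; split; first by apply: contraL za => /ab.
by apply: contraNneq Ma => <-.
Qed.

Lemma arranges_cat B a b : B \subset A :\ M ->
  arranges (A :\ M :\: B) a -> arranges B b -> arranges A (a ++ M :: b).
Proof.
move=> BA /arrangesP[Ua aE] /arrangesP[Ub bE]; apply/arrangesP; split.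
  rewrite cat_uniq cons_uniq Ua Ub bE !andbT /= aE !inE eqxx andbF /=.
  apply/andP; split; first by apply/hasPn => z; rewrite aE bE !inE => ->.
  by apply/negP => /(subsetP BA); rewrite !inE eqxx.
move=> z; rewrite mem_cat inE aE bE !inE.
case: eqP => [->|_] /=; first by rewrite MA orbT.
case: (boolP (z \in B)) => [/(subsetP BA)|_] /=; last by rewrite orbF.
by rewrite !inE => /andP[].
Qed.

Lemma all_lt_max C w : C \subset A :\ M -> arranges C w ->
  all (fun z : 'I_n => (z < M)%N) w.
Proof.
move=> CA /arrangesP[_ wC]; apply/allP => z; rewrite wC => zC.
exact/lt_max/(subsetP CA).
Qed.

(** The case where M still belongs to the open cycle; B collects the letters after M. *)
Lemma tail_open B p : B \subset A :\ M -> tail B p ->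
  tail A (decreasing (A :\ M :\: B) ++ M :: p.1, p.2).
Proof.
move=> BA /and4P[arr av std sz]; have dec := arranges_decreasing (A :\ M :\: B).
rewrite /tail /= std sz !andbT -catA cat_cons (arranges_cat BA) //.
rewrite avoids_12_3_max ?av ?decreasing_sorted //.
  exact: all_lt_max (subsetDl _ _) dec.
exact: all_lt_max BA arr.
Qed.

(** The case where the open cycle ends and a new one starts with m M. As the minimum, m prolongs the
    decreasing letters without an ascent and is a legitimate head. *)
Lemma tail_close m B p : m \in A :\ M -> (forall z, z \in A -> (m <= z)%N) ->
  B \subset A :\ M :\ m -> tail B p ->
  tail A (decreasing (A :\ M :\ m :\: B), (m :: M :: p.1) :: p.2).
Proof.
move=> mA minm BA /and4P[arr av std sz].
have BA' : B \subset A :\ M by apply: subset_trans BA (subsetDl _ _).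
have arrm : arranges (A :\ M :\: B) (rcons (decreasing (A :\ M :\ m :\: B)) m).
  have /arrangesP[Ud dE] := arranges_decreasing (A :\ M :\ m :\: B).
  apply/arrangesP; rewrite rcons_uniq Ud dE !inE eqxx andbF; split=> // z.
  rewrite mem_rcons inE dE !inE; case: eqP => //= ->.
  move: mA; rewrite !inE => ->; rewrite andbT; apply/esym/negP => /(subsetP BA).
  by rewrite !inE eqxx.
rewrite /tail /= std sz !andbT.
rewrite -cat_rcons.
rewrite (arranges_cat BA') // avoids_12_3_max ?av ?andbT.
- rewrite lt_max //=; apply/andP; split; last first.
    apply/allP => z zw; have zB : z \in B by case/arrangesP: arr => _ <-.
    have := subsetP BA z zB; rewrite !inE => /and3P[zm _ zA].
    by rewrite ltn_neqAle eq_sym val_eqE zm minm.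
  rewrite sorted_rcons_ge decreasing_sorted andbT; apply/allP => z.
  have /arrangesP[_ ->] := arranges_decreasing (A :\ M :\ m :\: B).
  by rewrite !inE => /and4P[_ _ _ /minm].
- exact: all_lt_max (subsetDl _ _) arrm.
exact: all_lt_max BA' arr.
Qed.

(** If M is not in the open cycle, the first new cycle starts with an ascent h d, since it has at
    least two letters. This forces d = M. Then h ends the decreasing part and precedes only larger
    letters, so it is the minimum of A. *)
Lemma tail_inv r css : tail A (r, css) ->
     (exists B p, [/\ B \subset A :\ M, tail B p &
        (r, css) = (decreasing (A :\ M :\: B) ++ M :: p.1, p.2)])
  \/ (exists m B p, [/\ m \in A :\ M, forall z, z \in A -> (m <= z)%N,
        B \subset A :\ M :\ m, tail B p &
        (r, css) = (decreasing (A :\ M :\ m :\: B), (m :: M :: p.1) :: p.2)]).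
Proof.
case/and4P=> /= arr av std sz; case: (boolP (M \in r)) => [/path.splitPr Mr|Mr].
  case: r / Mr arr av => a r' arr av; left.
  rewrite -catA cat_cons in arr av.
  have [arra arrb BA] := arranges_split arr.
  exists [set z in r' ++ flatten css], (r', css).
  rewrite avoids_12_3_max in av; last 2 first.
  - exact: all_lt_max (subsetDl _ _) arra.
  - exact: all_lt_max BA arrb.
  case/andP: av => sa av; split=> //.
    by rewrite /tail /= std sz av arrb.
  by rewrite (sorted_arranges arra sa).
have Mw : M \in r ++ flatten css by case/arrangesP: arr => _ ->.
case: css std sz arr av Mw => [|[//|h [//|d t]] css] /=.
  by rewrite cats0 (negPf Mr).
rewrite mem_cat (negPf Mr) /= => /andP[/andP[lt_hd lt_h] std] sz arr av.
have leM z : z \in r ++ [:: h, d & t ++ flatten css] -> (z <= M)%N.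
  by move=> zw; apply: maxM; case/arrangesP: arr => _ <-.
have ledM : (d <= M)%N by apply: leM; rewrite mem_cat !inE eqxx !orbT.
have := avoids_12_3_catr av; rewrite /= lt_hd => /and3P[/allP le_d _ _] Mw.
(* Avoidance after the ascent h d bounds all later letters by d, while M is among h, d and those
   letters, and h < d. *)
have {Mw ledM le_d} Md : M = d.
  apply/val_inj/eqP; rewrite eqn_leq ledM andbT.
  move: Mw; rewrite !inE => /or3P[/eqP Mh|/eqP-> //|/le_d //].
  by move: (leq_trans lt_hd ledM); rewrite -Mh ltnn.
rewrite -{d}Md in lt_hd arr av leM *; right.
rewrite -cat_rcons in arr av.
have [arra arrb BA] := arranges_split arr.
set B := [set z in _] in arra arrb BA.
rewrite avoids_12_3_max in av; last 2 first.
- exact: all_lt_max (subsetDl _ _) arra.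
- exact: all_lt_max BA arrb.
case/andP: av => + av; rewrite sorted_rcons_ge => /andP[/allP minh sr].
have [_ wA] := arrangesP _ _ arr; have [Ua aE] := arrangesP _ _ arra.
have hA : h \in A :\ M :\: B by rewrite -aE mem_rcons mem_head.
have hB : h \notin B by case/setDP: hA.
exists h, B, (t, css); split.
- by case/setDP: hA.
- move=> z; rewrite -wA mem_cat mem_rcons !inE -orbA.
  case/or4P=> [/eqP-> //|/minh //|/eqP->|zw]; first exact: ltnW.
  by have /ltnW := allP lt_h z zw.
- by rewrite subsetD1 BA.
- by rewrite /tail /= std arrb av.
congr (_, _); apply: sorted_arranges sr; apply/arrangesP.
move: Ua; rewrite rcons_uniq => /andP[hr Ur]; split=> // z.
have := aE z; rewrite mem_rcons !inE; case: eqP => //= -> _.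
by rewrite (negPf hr) andbF.
Qed.

End SplitAtMax.

Lemma exists_max A : A != set0 ->
  exists2 M, M \in A & forall z, z \in A -> (z <= M)%N.
Proof.
by case/set0Pn=> i0 i0A; exists [arg max_(i > i0 in A) val i]; case: arg_maxnP.
Qed.

Lemma exists_min A : A != set0 ->
  exists2 m, m \in A & forall z, z \in A -> (m <= z)%N.
Proof.
by case/set0Pn=> i0 i0A; exists [arg min_(i < i0 in A) val i]; case: arg_minnP.
Qed.

Lemma tail_determines_set A B p : tail A p -> tail B p -> A = B.
Proof.
by case/andP=> /andP[_ /eqP <-] _ /andP[/andP[_ /eqP <-] _].
Qed.

Lemma cat_cons_inj M a a' b b' : M \notin a -> M \notin a' ->
  a ++ M :: b = a' ++ M :: b' -> a = a' /\ b = b'.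
Proof.
elim: a a' => [|c a IHa] [|d a'] //=; rewrite ?inE ?negb_or.
- by move=> _ _ [].
- by move=> _ /andP[/eqP Md _] [].
- by move=> /andP[/eqP Mc _] _ [/esym].
by move=> /andP[_ Ma] /andP[_ Ma'] [-> /(IHa _ Ma Ma')[-> ->]].
Qed.

(** * Weighted enumeration of the tails of a set *)

Section Enumeration.

Variables (R : comNzRingType) (u : R) (F : nat -> R).
Hypotheses (F0 : F 0 = 1) (F1 : F 1 = 1).
Hypothesis FSS : forall k, F k.+2 =
  \sum_(j < k.+1) ((1 + u) * F j + F j.+1) *+ 'C(k, j).

(** Strong induction on the size of A through the decomposition at the maximum. Pairs of lists form
    an infinite type, so the sum runs over an explicit list without repetition. *)
Lemma tail_enumeration A : exists L : seq (seq 'I_n * seq (seq 'I_n)),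
  [/\ uniq L, forall p, (p \in L) = tail A p &
      \sum_(p <- L) u ^+ size p.2 = F #|A|].
Proof.
have [k] := ubnP #|A|; elim: k A => // k IHk A; rewrite ltnS => leAk.
have [->|A_neq0] := eqVneq A set0.
  exists [:: ([::], [::])]; split=> // [p|]; first by rewrite inE tail_set0.
  by rewrite big_seq1 cards0 F0.
have [M MA maxM] := exists_max A_neq0.
have cardA := cardsD1 M A; rewrite MA /= add1n in cardA.
have {IHk} [L LP] : exists L, forall B, B \subset A :\ M ->
    [/\ uniq (L B), forall p, (p \in L B) = tail B p &
      \sum_(p <- L B) u ^+ size p.2 = F #|B|].
  apply: (@fin_all_exists _ _ (fun B L => B \subset A :\ M ->
    [/\ uniq L, forall p, (p \in L) = tail B p &
      \sum_(p <- L) u ^+ size p.2 = F #|B|])).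
  move=> B; case: (boolP (B \subset A :\ M)) => [BA|_]; last by exists [::].
  have [|L LP] := IHk B; last by exists L.
  by rewrite (leq_trans _ leAk) // cardA ltnS subset_leq_card.
pose L1 := [seq (decreasing (A :\ M :\: B) ++ M :: p.1, p.2) |
  B <- enum (powerset (A :\ M)), p <- L B].
have notM B : M \notin decreasing (A :\ M :\: B).
  have /arrangesP[_ ->] := arranges_decreasing (A :\ M :\: B).
  by rewrite !inE eqxx andbF.
have U1 : uniq L1.
  apply: allpairs_uniq_dep => [|B|]; first exact: enum_uniq.
    by rewrite mem_enum powersetE => /LP[].
  move=> _ _ /allpairsPdep[B [p [BA pB ->]]] /allpairsPdep[C [q [CA qC ->]]] /=.
  move: BA CA; rewrite !mem_enum !powersetE => BA CA [].
  move=> /(cat_cons_inj (notM B) (notM C))[_ eq1] eq2.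
  have [[_ LB _] [_ LC _]] := (LP B BA, LP C CA).
  have eqpq : p = q.
    by rewrite [p]surjective_pairing eq1 eq2 -surjective_pairing.
  move: qC pB; rewrite -{}eqpq LB LC => tC tB.
  by rewrite (tail_determines_set tB tC).
have mem1 p : reflect (exists B q, [/\ B \subset A :\ M, tail B q &
    p = (decreasing (A :\ M :\: B) ++ M :: q.1, q.2)]) (p \in L1).
  apply: (iffP allpairsPdep) => -[B [q [BA qB ->]]]; exists B, q.
    by move: BA; rewrite mem_enum powersetE => BA; case/LP: (BA) => _ <-.
  by rewrite mem_enum powersetE BA; case/LP: (BA) => _ ->.
have sum1 : \sum_(p <- L1) u ^+ size p.2 = \sum_(B in powerset (A :\ M)) F #|B|.
  rewrite big_allpairs_dep -big_enum /=; apply: eq_big_seq => B.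
  by rewrite mem_enum powersetE => /LP[_ _ <-].
(* With M as the only letter, no new cycle of length two can start, so only the open case
   remains. *)
have [A'0|A'_neq0] := eqVneq (A :\ M) set0.
  exists L1; split=> // [p|].
    apply/mem1/idP => [[B [q [BA qB ->]]]|]; first exact: tail_open.
    case: p => r css /(tail_inv MA maxM)[//|[m [_ [_ [+ _ _ _ _]]]]].
    by rewrite A'0 inE.
  by rewrite sum1 cardA A'0 cards0 F1 powerset0 big_set1 cards0 F0.
have [m mA minm] := exists_min A'_neq0.
have {}minm z : z \in A -> (m <= z)%N.
  have [-> _|zM zA] := eqVneq z M; first exact/ltnW/(lt_max maxM).
  by apply: minm; rewrite !inE zM.
pose L2 := [seq (decreasing (A :\ M :\ m :\: B), (m :: M :: p.1) :: p.2) |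
  B <- enum (powerset (A :\ M :\ m)), p <- L B].
have subA' B : B \subset A :\ M :\ m -> B \subset A :\ M.
  by move=> BA; apply: subset_trans BA (subsetDl _ _).
have U2 : uniq L2.
  apply: allpairs_uniq_dep => [|B|]; first exact: enum_uniq.
    by rewrite mem_enum powersetE => /subA'/LP[].
  move=> _ _ /allpairsPdep[B [p [BA pB ->]]] /allpairsPdep[C [q [CA qC ->]]] /=.
  move: BA CA; rewrite !mem_enum !powersetE => BA CA [] _ eq1 eq2.
  have [[_ LB _] [_ LC _]] := (LP B (subA' _ BA), LP C (subA' _ CA)).
  have eqpq : p = q.
    by rewrite [p]surjective_pairing eq1 eq2 -surjective_pairing.
  move: qC pB; rewrite -{}eqpq LB LC => tC tB.
  by rewrite (tail_determines_set tB tC).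
have mem2 p : reflect (exists B q, [/\ B \subset A :\ M :\ m, tail B q &
    p = (decreasing (A :\ M :\ m :\: B), (m :: M :: q.1) :: q.2)]) (p \in L2).
  apply: (iffP allpairsPdep) => -[B [q [BA qB ->]]]; exists B, q.
    by move: BA; rewrite mem_enum powersetE => BA; case/subA'/LP: (BA) => _ <-.
  by rewrite mem_enum powersetE BA; case/subA'/LP: (BA) => _ ->.
have sum2 : \sum_(p <- L2) u ^+ size p.2 =
    u * \sum_(B in powerset (A :\ M :\ m)) F #|B|.
  rewrite big_allpairs_dep -big_enum mulr_sumr /=; apply: eq_big_seq => B.
  rewrite mem_enum powersetE => /subA'/LP[_ _ <-]; rewrite mulr_sumr.
  by apply: eq_bigr => p _; rewrite exprS.
exists (L1 ++ L2); split=> [|p|].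
(* The lists are disjoint: M lies in the first component for [L1] and not for [L2]. *)
- rewrite cat_uniq U1 U2 andbT; apply/hasPn => _ /mem2[B [q [BA _ ->]]].
  apply/negP => /mem1[C [q' [_ _ [eqr _]]]].
  have := arranges_decreasing (A :\ M :\ m :\: B).
  case/arrangesP=> _ /(_ M); rewrite eqr mem_cat mem_head orbT !inE eqxx.
  by rewrite !andbF.
- rewrite mem_cat; apply/orP/idP => [[/mem1[B [q [BA qB ->]]]|]|].
  + exact: tail_open.
  + by case/mem2=> B [q [BA qB ->]]; apply: tail_close.
  case: p => r css /(tail_inv MA maxM)[H|]; first by left; apply/mem1.
  move=> [m' [B [q [m'A minm' BA qB ->]]]]; right; apply/mem2.
  suff eqm : m' = m by rewrite eqm in BA *; exists B, q.
  apply/val_inj/eqP; move: mA m'A; rewrite !inE => /andP[_ mA] /andP[_ m'A].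
  by rewrite eqn_leq minm' ?minm.
have mA' : m \notin A :\ M :\ m by rewrite !inE eqxx.
have cardA2 : #|A| = #|A :\ M :\ m|.+2 by rewrite cardA (cardsD1 m (A :\ M)) mA.
(* For each B without m, the open case gives F(|B|) + F(|B| + 1), according to whether m is added to
   B, and the closing case gives u F(|B|). *)
rewrite big_cat sum1 sum2 -{1}(setD1K mA) sum_powersetU1 //= mulr_sumr.
rewrite -big_split cardA2 FSS -(sum_powerset_card
  (fun j => (1 + u) * F j + F j.+1)); apply: eq_bigr => B.
rewrite powersetE => BA; rewrite cardsU1.
have -> : m \notin B by apply: contra mA' => /(subsetP BA).
by rewrite add1n /=; ring.
Qed.

End Enumeration.
End Tails.

(** * Standard cycle forms *)

Lemma contains_12_3_cons (c : nat) (w : seq nat) : contains_12_3 (c :: w) =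
  (if w is d :: v then (c < d)%N && has (fun e => (d < e)%N) v else false)
  || contains_12_3 w.
Proof.
apply/existsP/orP => [[i /existsP[k]]|[]].
- case: i k => [[|i] lti] [[|k] ltk] //=.
    case: w lti ltk => [//|d v] lti ltk /=; case: k ltk => [|k] //= ltk.
    move=> /andP[-> ltd]; left => /=; apply/hasP.
    by exists (nth 0%N v k) => //; apply: mem_nth; rewrite /= !ltnS in ltk.
  move=> H; right; apply/existsP; exists (Ordinal (lti : (i < size w)%N)).
  by apply/existsP; exists (Ordinal (ltk : (k < size w)%N)).
- case: w => // d v /andP[cd /hasP[e ev de]].
  exists ord0; apply/existsP.
  have ltk : ((index e v).+2 < size [:: c, d & v])%N.
    by rewrite /= !ltnS index_mem.
  by exists (Ordinal ltk); rewrite /= cd nth_index.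
case/existsP=> i /existsP[k H].
exists (lift ord0 i); apply/existsP; exists (lift ord0 k).
by rewrite /= /bump /= !add1n ltnS.
Qed.

Section StandardCycleForm.

Variable n : nat.
Implicit Types (s t : 'S_n) (css : seq (seq 'I_n)) (c : seq 'I_n).

Lemma contains_12_3_flat s :
  contains_12_3 (flat s) = ~~ avoids_12_3 (flatten (standard_cycle_form s)).
Proof.
rewrite /flat; elim: (flatten _) => [|c w IHw].
  by apply/negbTE/existsP => -[[]].
rewrite map_cons contains_12_3_cons {}IHw [avoids_12_3 _]/= negb_and.
congr (_ || _).
case: w => // d v /=; rewrite negb_imply ltnS has_map -has_predC.
by congr (_ && _); apply: eq_has => e /=; rewrite ltnS ltnNge.
Qed.

Lemma mem_orbit_porbit s i j :
  (j \in fingraph.orbit s i) = (j \in porbit s i).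
Proof.
rewrite -fconnect_orbit; apply/idP/porbitP => [/iter_findex <-|[k ->]].
  by exists (findex s i j); rewrite permX.
by rewrite permX fconnect_iter.
Qed.

Lemma orbit_cons s i : exists u, fingraph.orbit s i = i :: u.
Proof.
rewrite /fingraph.orbit -orderSpred.
by exists (traject s (s i) (fingraph.order s i).-1).
Qed.

Definition cycle_min s (i : 'I_n) : bool := [forall j in porbit s i, i <= j]%N.

Lemma cycle_minP s i :
  reflect (forall j, j \in porbit s i -> (i <= j)%N) (cycle_min s i).
Proof. exact: forall_inP. Qed.

Lemma porbit_mem_eq s i j : i \in porbit s j -> porbit s i = porbit s j.
Proof. by rewrite -eq_porbit_mem => /eqP. Qed.

Lemma exists_cycle_min s i : exists2 j, cycle_min s j & i \in porbit s j.
Proof.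
have [|j ji minj] := @exists_min n (porbit s i).
  by apply/set0Pn; exists i; apply: porbit_id.
exists j; last by rewrite (porbit_mem_eq ji) porbit_id.
by apply/cycle_minP => k; rewrite (porbit_mem_eq ji); apply: minj.
Qed.

Lemma cycle_min_eq s i j k : cycle_min s i -> cycle_min s j ->
  k \in porbit s i -> k \in porbit s j -> i = j.
Proof.
move=> /cycle_minP mini /cycle_minP minj.
move=> /porbit_mem_eq eqki /porbit_mem_eq eqkj.
have eqij : porbit s i = porbit s j by rewrite -eqki.
apply/val_inj/eqP; rewrite eqn_leq mini ?minj //.
  by rewrite -eqij porbit_id.
by rewrite eqij porbit_id.
Qed.

(** Orbits with different minima are disjoint, and each letter of a later orbit is at least its
    minimum, which exceeds i. *)
Lemma standard_orbits s (l : seq 'I_n) :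
  pairwise (fun i j : 'I_n => (i < j)%N) l -> all (cycle_min s) l ->
  standard [seq fingraph.orbit s i | i <- l]
  && uniq (flatten [seq fingraph.orbit s i | i <- l]).
Proof.
elim: l => //= i l IHl /andP[/allP lti pl] /andP[mini minl].
have /andP[std Ul] := IHl pl minl; rewrite std cat_uniq Ul orbit_uniq !andbT.
have min_i := cycle_minP _ _ mini.
apply/andP; split; last first.
  apply/hasPn => z /flattenP[_ /mapP[j jl ->] zj]; apply/negP => /= zi.
  rewrite !mem_orbit_porbit in zi zj.
  have /lti := jl; rewrite (cycle_min_eq mini _ zi zj) ?ltnn //.
  exact: (allP minl).
have [u Eu] := orbit_cons s i; rewrite Eu all_cat; apply/andP; split.
  apply/allP => e eu; have := orbit_uniq s i; rewrite Eu /= => /andP[iu _].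
  rewrite ltn_neqAle min_i ?andbT; last first.
    by rewrite -mem_orbit_porbit Eu inE eu orbT.
  by apply: contraNneq iu => /val_inj ->.
apply/allP => e /flattenP[_ /mapP[j jl ->] ej]; rewrite mem_orbit_porbit in ej.
apply: leq_trans (lti j jl) _.
exact: (cycle_minP _ _ (allP minl j jl)).
Qed.

Lemma mem_standard_cycle_form s c : reflect
  (exists2 i, cycle_min s i & c = fingraph.orbit s i)
  (c \in standard_cycle_form s).
Proof.
apply: (iffP mapP) => -[i mini ->]; exists i => //.
  by move: mini; rewrite mem_filter => /andP[].
by rewrite mem_filter mem_enum andbT.
Qed.

Lemma standard_cycle_form_standard s :
  standard (standard_cycle_form s) && uniq (flatten (standard_cycle_form s)).
Proof.
apply: standard_orbits; last exact: filter_all.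
rewrite -sorted_pairwise; last by move=> j i k; apply: ltn_trans.
apply: sorted_filter; first by move=> j i k; apply: ltn_trans.
by have := iota_ltn_sorted 0 n; rewrite -val_enum_ord sorted_map.
Qed.

Lemma mem_flatten_standard_cycle_form s i :
  i \in flatten (standard_cycle_form s).
Proof.
have [j minj ij] := exists_cycle_min s i; apply/flattenP.
exists (fingraph.orbit s j); last by rewrite mem_orbit_porbit.
by apply/mem_standard_cycle_form; exists j.
Qed.

Lemma size_standard_cycle_form s : size (standard_cycle_form s) = #|porbits s|.
Proof.
rewrite size_map; set l := [seq i <- _ | _].
have lE i : (i \in l) = cycle_min s i by rewrite mem_filter mem_enum andbT.
have <- : #|l| = size l by apply/card_uniqP; rewrite filter_uniq ?enum_uniq.
rewrite -(@card_in_imset _ _ (porbit s)) => [|i j]; last first.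
  rewrite !lE => mini minj eqij; apply: (cycle_min_eq (k := i) mini minj).
    exact: porbit_id.
  by rewrite -eqij porbit_id.
apply: eq_card => c; apply/imsetP/imsetP => -[i li ->]; first by exists i.
have [j minj ij] := exists_cycle_min s i; exists j; first by rewrite lE.
exact: porbit_mem_eq.
Qed.

Lemma derangement_size s :
  derangement s = all (fun c => 1 < size c)%N (standard_cycle_form s).
Proof.
apply/forallP/allP => [der _ /mem_standard_cycle_form[i _ ->]|sz i].
  have := der i; rewrite size_orbit; apply: contraNltn => ord1.
  have : s i \in fingraph.orbit s i by rewrite -fconnect_orbit fconnect1.
  rewrite /fingraph.orbit; case: (fingraph.order s i) ord1 => [|[|]] // _.
  by rewrite inE.
apply/eqP => fix_i; have [j minj /porbit_mem_eq eqij] := exists_cycle_min s i.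
have /porbitP[k jk] : j \in porbit s i by rewrite eqij porbit_id.
have ij : j = i by rewrite jk permX; elim: k {jk} => //= k ->.
have /sz : fingraph.orbit s j \in standard_cycle_form s.
  by apply/mem_standard_cycle_form; exists j.
by rewrite size_orbit ij (@order_cycle _ s [:: i]) /= ?fix_i ?eqxx ?mem_head.
Qed.

(** The image of i is the letter cyclically following i in its cycle, so the cycles determine the
    permutation. *)
Lemma standard_cycle_form_inj : injective (@standard_cycle_form n).
Proof.
move=> s t eqst; apply/permP => i.
have /flattenP[c cs ic] := mem_flatten_standard_cycle_form s i.
have cycE u : c \in standard_cycle_form u -> u i = next c i.
  case/mem_standard_cycle_form=> j _ cE; apply/eqP.
  have cyc := cycle_orbit (@perm_inj _ u) j; rewrite -cE in cyc.
  exact: next_cycle cyc ic.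
by rewrite (cycE s) // (cycE t) // -eqst.
Qed.

(** * Recovering a permutation from a standard list of cycles *)

Definition lt_head (c d : seq 'I_n) : bool :=
  if c is h :: _ then if d is k :: _ then (h < k)%N else false else false.

Lemma lt_head_trans : transitive lt_head.
Proof. by move=> [|j d] [|i c] [|k e] //=; apply: ltn_trans. Qed.

Lemma standard_nil css : standard css -> [::] \notin css.
Proof. by elim: css => //= -[|h c] css IH //= /andP[_ /IH]; rewrite inE. Qed.

Lemma standard_sorted css : standard css -> sorted lt_head css.
Proof.
rewrite (sorted_pairwise lt_head_trans); elim: css => //= -[//|h c] css IHcss.
move=> /andP[/allP lth std]; rewrite IHcss // andbT.
apply/allP => -[|k d] dcss; first by have := standard_nil std; rewrite dcss.
by apply: lth; rewrite mem_cat; apply/orP; right; apply/flattenP;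
  exists (k :: d); rewrite ?mem_head.
Qed.

Lemma standard_head_min css h c : standard css -> h :: c \in css ->
  forall i, i \in h :: c -> (h <= i)%N.
Proof.
elim: css => //= -[//|k d] css IHcss /andP[/allP ltk std].
rewrite inE => /predU1P[[-> ->] i|/(IHcss std)//].
rewrite inE => /predU1P[-> //|ic]; apply/ltnW/ltk.
by rewrite mem_cat ic.
Qed.

Lemma foldr_next_out css i :
  i \notin flatten css -> foldr (fun c j => next c j) i css = i.
Proof.
elim: css => //= c css IHcss; rewrite mem_cat negb_or => /andP[ic icss].
by rewrite IHcss // next_nth (negPf ic).
Qed.

Lemma foldr_next css c i : uniq (flatten css) -> c \in css -> i \in c ->
  foldr (fun c j => next c j) i css = next c i.
Proof.
elim: css => //= d css IHcss; rewrite cat_uniq => /and3P[_ /hasPn dcss Ucss].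
rewrite inE => /predU1P[-> ic|ccss ic].
  by rewrite foldr_next_out //; apply: contraL ic => /dcss.
rewrite (IHcss Ucss ccss ic) next_nth (_ : _ \in d = false) //.
apply/negbTE/dcss/flattenP; exists c => //.
by rewrite mem_next.
Qed.

(** The permutation is the composition of the rotations [next c]. The cycles being disjoint, only
    one of them moves a given letter. *)
Lemma standard_cycle_form_surj css :
  standard css -> uniq (flatten css) -> (forall i, i \in flatten css) ->
  exists s, standard_cycle_form s = css.
Proof.
move=> std Ucss full.
have Uc c : c \in css -> uniq c.
  elim: css Ucss {std full} => //= d css IHcss; rewrite cat_uniq.
  by case/and3P=> Ud _ /IHcss{}IHcss; rewrite inE => /predU1P[->|].
have inj : injective (fun i => foldr (fun c j => next c j) i css).
  elim: css {std full Ucss} Uc => [_ i j //|c css IHcss Uc i j /=].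
  move/(can_inj (prev_next (Uc c (mem_head _ _)))); apply: IHcss => d dcss.
  by apply: Uc; rewrite inE dcss orbT.
pose s := perm inj; exists s.
have sE c i : c \in css -> i \in c -> s i = next c i.
  by move=> ccss ic; rewrite permE; apply: foldr_next.
have cyc c : c \in css -> fcycle s c.
  move=> ccss; rewrite (@eq_in_cycle _ (mem c) _ (frel (next c))).
  - exact/cycle_next/Uc.
  - by move=> i j ic _ /=; rewrite (sE c).
  exact/allP.
have orb h c : h :: c \in css -> fingraph.orbit s h = h :: c.
  move=> hc; rewrite (fingraph.orbitE (cyc _ hc) (Uc _ hc)) ?mem_head //.
  by rewrite /= eqxx rot0.
(* Both lists are strictly sorted by heads, so it is enough that they have the same cycles. *)
apply: (irr_sorted_eq lt_head_trans).
- by case=> //= h c; rewrite ltnn.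
- by apply: standard_sorted; case/andP: (standard_cycle_form_standard s).
- exact: standard_sorted.
move=> c; apply/mem_standard_cycle_form/idP => [[i mini ->]|ccss].
  have /flattenP[[//|h d] dcss id] := full i.
  have hi : h \in porbit s i.
    by rewrite porbit_sym -mem_orbit_porbit (orb h d).
  suff -> : i = h by rewrite (orb h d).
  apply/val_inj/eqP; rewrite eqn_leq (cycle_minP _ _ mini) //=.
  exact: standard_head_min dcss _ id.
case: c ccss => [|h c] hc; first by have := standard_nil std; rewrite hc.
exists h; last by rewrite (orb h c).
apply/cycle_minP => j; rewrite -mem_orbit_porbit (orb h c) //.
exact: standard_head_min std hc j.
Qed.

Lemma mem_D_12_3 s : (s \in D_12_3 n) = tail setT ([::], standard_cycle_form s).
Proof.
rewrite inE contains_12_3_flat negbK derangement_size /tail /=.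
have /andP[-> Us] := standard_cycle_form_standard s.
rewrite andbC [X in X && (_ && _)](_ : _ = true) //.
apply/arrangesP; split=> // i; rewrite inE.
exact: mem_flatten_standard_cycle_form.
Qed.

Lemma tail_standard_cycle_form css : tail setT ([::], css) ->
  exists2 s, s \in D_12_3 n & standard_cycle_form s = css.
Proof.
move=> tl; have /and4P[/arrangesP[Ucss full] _ std _] := tl.
have [|s sE] := standard_cycle_form_surj std Ucss.
  by move=> i; rewrite full inE.
by exists s => //; rewrite mem_D_12_3 sE.
Qed.

End StandardCycleForm.

(** No cycle is open at the start, so the first one begins with the minimum and the maximum. It
    contributes 'X, and any tail on the other k + 1 letters may follow. *)
Lemma d_12_3_tail_poly k : d_12_3 k.+3 = 'X * tail_poly 'X k.+1.
Proof.
pose A : {set 'I_k.+3} := setT :\ ord_max :\ ord0.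
have max_last (z : 'I_k.+3) : z \in setT -> (z <= @ord_max k.+2)%N.
  by rewrite leq_ord.
have min_first : ord0 \in [set: 'I_k.+3] :\ ord_max by rewrite !inE.
have [L [UL LE sumL]] :=
  @tail_enumeration _ {poly int} 'X (tail_poly 'X) erefl
    (tail_poly1 'X) (tail_polySS 'X) A.
have cardA : #|A| = k.+1.
  have := cardsD1 ord_max [set: 'I_k.+3]; rewrite cardsT card_ord inE => -[].
  by rewrite (cardsD1 ord0 (_ :\ _)) min_first => -[].
rewrite {}cardA in sumL; rewrite -sumL mulr_sumr.
transitivity (\sum_(css <- [seq standard_cycle_form s | s in D_12_3 k.+3])
    'X ^+ size css : {poly int}).
  rewrite big_map big_enum /=; apply: eq_bigr => s _.
  by rewrite size_standard_cycle_form.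
rewrite (perm_big [seq (ord0 :: ord_max :: p.1) :: p.2 | p <- L]) /=.
  rewrite big_map.
  by apply: eq_bigr => p _; rewrite exprS.
apply: uniq_perm.
- by rewrite map_inj_uniq ?enum_uniq //; apply: standard_cycle_form_inj.
- by rewrite map_inj_uniq // => -[r css] [r' css'] [-> ->].
move=> css; apply/mapP/mapP => [[s]|[p]].
  (* The open case would put the maximum into an empty word. In the closing case the empty
     decreasing part forces B to be all of A. *)
  rewrite mem_enum mem_D_12_3 => + ->; case/(tail_inv (in_setT _) max_last).
    by move=> [B [p [_ _ [/(congr1 size)]]]]; rewrite size_cat addnS.
  move=> [m [B [p [mA minm BA tB [dec0 ->]]]]].
  have m0 : m = ord0 by apply/val_inj/eqP; rewrite -leqn0 (minm ord0).
  rewrite m0 in BA dec0 *; exists p => //; rewrite LE (_ : A = B) //.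
  apply/eqP; rewrite eqEsubset BA andbT -setD_eq0; apply/set0Pn => -[z].
  by have /arrangesP[_ <-] := arranges_decreasing (A :\: B); rewrite -dec0.
rewrite LE => tA ->; have := tail_close (in_setT _) max_last min_first
  (fun _ _ => isT) (subxx _) tA.
rewrite setDv /decreasing enum_set0 => /tail_standard_cycle_form[s sD <-].
by exists s => //; rewrite mem_enum.
Qed.

Theorem theorem2p9 :
  let x : fps {poly int} := fpsX {poly int} in
  let y : fps {poly int} := fpsC ('X : {poly int}) in
  exists2 S : fps {poly int},
    fps_has_sum (fun j : nat =>
      x ^+ j * \prod_(0 <= i < j.+1) (1 - i%:R * x + x * y)
      / ((1 - j.+1%:R * x) * \prod_(0 <= i < j.+1) (1 - i%:R * x) ^+ 2)) S
    & W = x ^+ 3 * y * S.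
Proof.
exists (summand_series 'X); first exact: summand_has_sum.
apply: fpsP => n; rewrite -mulrA coef_fpsXnM coef_fpsCM.
(* Below degree 3 both sides vanish; beyond, coefficient k of the sum is [tail_poly] at k + 1. *)
case: n => [|[|[|k]]] //; rewrite subSS !subSS subn0.
exact: d_12_3_tail_poly.
Qed.
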